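(* Let $m\ge 2$, let $r_1,\ldots,r_m$ be positive integers, let $k$ be a positive integer, write $B=B(k;r_1,\ldots,r_m)$ for the weighted star matrix, and let $$S=S(k;r_1,\ldots,r_m)=k-m+\sum_{i=1}^m\frac{1}{r_i+1}.$$ Then the inertia of $B$ is the sum of the inertia of the positive-definite block diagonal matrix $\operatorname{diag}(A_{r_1},\ldots,A_{r_m})$ and the inertia of the $1\times 1$ matrix $(S)$. Hence: (i) $B$ is positive definite if and only if $S>0$; (ii) $B$ is positive semidefinite of corank one if and only if $S=0$; (iii) $B$ has exactly one negative eigenvalue if and only if $S<0$. Moreover, if $S=0$, then every proper principal submatrix of $B$ is positive definite.
   Context: For a positive integer $r$, $A_r$ denotes the Cartan matrix of type $A_r$: the $r\times r$ tridiagonal matrix with all diagonal entries equal to $2$ and all entries immediately above and below the diagonal equal to $-1$ (so $A_1=(2)$). For each $i$, let $v_i\in\mathbb{Z}^{r_i}$ be the column vector whose entries are all zero except the last one, which is $-1$. The weighted star matrix is the symmetric integer matrix of size $1+\sum_{i=1}^m r_i$ $$B(k;r_1,\ldots,r_m)=\begin{pmatrix} A_{r_1}&0&\cdots&0&v_1\\ 0&A_{r_2}&\cdots&0&v_2\\ \vdots&\vdots&\ddots&\vdots&\vdots\\ 0&0&\cdots&A_{r_m}&v_m\\ v_1^t&v_2^t&\cdots&v_m^t&k\end{pmatrix}.$$ The inertia of a real symmetric matrix is the triple (number of positive eigenvalues, number of negative eigenvalues, number of zero eigenvalues), counted with multiplicity; inertias are added componentwise. Corank means the dimension of the kernel. 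*)

(* Defs.v *)
From mathcomp Require Import all_boot all_order all_algebra.
From mathcomp Require Import polyrcf.

Set Implicit Arguments.
Unset Strict Implicit.
Unset Printing Implicit Defensive.

Import Order.TTheory GRing.Theory Num.Theory.
Local Open Scope ring_scope.

Definition cartanA (r : nat) : 'M[int]_r :=
  \matrix_(i, j) if i == j then 2
                 else if ((i : nat) == j.+1) || ((j : nat) == i.+1) then -1
                 else 0.

Definition star_leg (r : nat) : 'cV[int]_r :=
  \col_i if i.+1 == r then -1 else 0.

Definition star_diag (m : nat) (r : 'I_m -> nat) : 'M[int]_(\sum_i r i) :=
  \mxdiag_i cartanA (r i).

Definition star_col (m : nat) (r : 'I_m -> nat) : 'cV[int]_(\sum_i r i) :=
  \mxcol_i star_leg (r i).

Definition star_mx (k : int) (m : nat) (r : 'I_m -> nat) :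
    'M[int]_(\sum_i r i + 1) :=
  block_mx (star_diag r) (star_col r) (star_col r)^T k%:M.

Definition star_S (R : fieldType) (k : int) (m : nat) (r : 'I_m -> nat) : R :=
  k%:~R - m%:R + \sum_(i < m) ((r i).+1%:R)^-1.

(* Number of real eigenvalues of M satisfying P, counted with (algebraic)
   multiplicity.  [rootsR] lists each root once, hence the sum of the
   multiplicities; the characteristic polynomial, being monic, is nonzero. *)
Definition eigenvalue_count (R : rcfType) (P : pred R) (n : nat)
    (M : 'M[R]_n) : nat :=
  (\sum_(x <- rootsR (char_poly M) | P x) mup x (char_poly M))%N.

(* (positive, negative, zero); as an element of nat * nat * nat it is added
   componentwise. *)
Definition inertia (R : rcfType) (n : nat) (M : 'M[R]_n) : nat * nat * nat :=
  (eigenvalue_count (fun x => 0 < x) M,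
   eigenvalue_count (fun x => x < 0) M,
   eigenvalue_count (fun x => x == 0) M).

Definition posdefmx (R : numDomainType) (n : nat) (M : 'M[R]_n) : Prop :=
  M^T = M /\ forall x : 'cV[R]_n, x != 0 -> 0 < (x^T *m M *m x) 0 0.

Definition possemidefmx (R : numDomainType) (n : nat) (M : 'M[R]_n) : Prop :=
  M^T = M /\ forall x : 'cV[R]_n, 0 <= (x^T *m M *m x) 0 0.

(* The columns of [cokermx M] span the column vectors x with M *m x = 0. *)
Definition corank (F : fieldType) (n : nat) (M : 'M[F]_n) : nat :=
  \rank (cokermx M).

(* [enum_val] lists the elements of J in increasing order. *)
Definition principal_submx (T : Type) (n : nat) (J : {set 'I_n})
    (M : 'M[T]_n) : 'M[T]_#|J| :=
  mxsub (@enum_val _ (mem J)) (@enum_val _ (mem J)) M.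

(* Main.v *)
Require Import Defs.
From mathcomp Require Import all_boot all_order all_algebra.
From mathcomp Require Import polyrcf complex ring zify.

Set Implicit Arguments.
Unset Strict Implicit.
Unset Printing Implicit Defensive.

Import Order.TTheory GRing.Theory Num.Theory.
Local Open Scope ring_scope.

(** Write D for the block diagonal matrix of the legs, c for the last column of
B above its corner, and suppose D w = c. Eliminating c with the shear
U = (1 w; 0 1) gives B = U^T (D (+) (s)) U with s = k - c^T w
([schur_congr]), and everything follows from this congruence.

The vector w is explicit: on a leg of length r its entries are
-1/(r+1), ..., -r/(r+1) ([cartanR_leg_sol]), so that leg contributes
r/(r+1) = 1 - 1/(r+1) to c^T w, and s is exactly S. Each A_r is the Gram matrix
of an injective difference operator ([cartanR_gram]), hence D is positive
definite.

The inertia counts eigenvalues with multiplicity, whereas the congruence only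
speaks of the quadratic form, so Sylvester's law of inertia is needed
([inertia_congr]). Over a real closed field R it is obtained by extending
scalars to R[i]: the spectral theorem there shows that the characteristic
polynomial of a real symmetric matrix splits over R ([real_spectral]), and a
dimension count shows that two diagonalisations of one hermitian form have
equally many positive entries ([card_pos_le_congr]).

Definiteness, semidefiniteness and the corank are read off D (+) (S) directly.
If S = 0, the form of B at (a, t) is the form of D at a + w t, which vanishes
only on the multiples of (-w, 1). All coordinates of that vector are nonzero,
so no nonzero vector supported on a proper subset of the indices is isotropic
([posdef_principal_schur]). *)

(** * Spectral theorem and Sylvester's law of inertia *)

Section Inertia.
Local Open Scope sesquilinear_scope.

Lemma hermitian_form_diag (C : numClosedFieldType) n (Q : 'M[C]_n)
    (e : 'rV[C]_n) (x : 'rV[C]_n) :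
  (x *m (Q *m diag_mx e *m Q^t*) *m x^t*) 0 0
    = \sum_i e 0 i * `|(x *m Q) 0 i| ^+ 2.
Proof.
rewrite !mulmxA -[_ *m Q^t* *m _]mulmxA.
have -> : Q^t* *m x^t* = (x *m Q)^t* by rewrite trmx_mul map_mxM.
rewrite mxE; apply: eq_bigr => i _; rewrite mul_mx_diag !mxE normCK.
by rewrite [_ * e 0 i]mulrC mulrA.
Qed.

(** If e had more positive entries than d, the conditions that the coordinates
of x P vanish where d > 0 and those of x Q vanish where e <= 0 would be fewer
than n, so some x <> 0 would satisfy them all; its form is then nonpositive when
computed with d, and positive when computed with e. *)
Lemma card_pos_le_congr (C : numClosedFieldType) n (P Q : 'M[C]_n)
    (d e : 'rV[C]_n) :
  d \is a realmx -> e \is a realmx -> Q \in unitmx ->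
  P *m diag_mx d *m P^t* = Q *m diag_mx e *m Q^t* ->
  (#|[set i | (0 < e 0 i)%R]| <= #|[set i | (0 < d 0 i)%R]|)%N.
Proof.
move=> /mxOverP d_real /mxOverP e_real Q_unit eqPQ.
set E := [set i | _]; set D := [set i | _]; rewrite leqNgt; apply/negP => ltDE.
(* The left kernel of N consists of the x meeting all those conditions. *)
pose N := row_mx (colsub (@enum_val _ (mem D)) P)
                 (colsub (@enum_val _ (mem (~: E))) Q).
have [x xN0 x_neq0] : exists2 x : 'rV[C]_n, x *m N = 0 & x != 0.
  have /rowV0Pn[x /sub_kermxP xN0 x_neq0] : kermx N != 0.
    rewrite -mxrank_eq0 mxrank_ker -lt0n subn_gt0.
    apply: leq_ltn_trans (rank_leq_col _) _.
    by rewrite -[X in (_ < X)%N](card_ord n) -(cardsC E) ltn_add2r.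
  by exists x.
have := xN0; rewrite mul_mx_row !mulmx_colsub -[0]row_mx0.
move=> /eq_row_mx[/rowP xP0 /rowP xQ0].
have xP0' i : 0 < d 0 i -> (x *m P) 0 i = 0.
  move=> di; have Di : i \in D by rewrite inE.
  by have := xP0 (enum_rank_in Di i); rewrite mxE enum_rankK_in// => ->; rewrite mxE.
have xQ0' i : ~~ (0 < e 0 i) -> (x *m Q) 0 i = 0.
  move=> ei; have Ei : i \in ~: E by rewrite !inE.
  by have := xQ0 (enum_rank_in Ei i); rewrite mxE enum_rankK_in// => ->; rewrite mxE.
have := congr1 (fun M => (x *m M *m x^t*) 0 0) eqPQ.
rewrite !hermitian_form_diag => eq_form.
have term_ge0 i : 0 <= e 0 i * `|(x *m Q) 0 i| ^+ 2.
  have [ei|/xQ0'->] := boolP (0 < e 0 i); last by rewrite normr0 expr0n mulr0.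
  by rewrite mulr_ge0 ?exprn_ge0// ltW.
have /psumr_eq0P form_eq0 : \sum_i e 0 i * `|(x *m Q) 0 i| ^+ 2 = 0.
  apply/le_anti; rewrite sumr_ge0 ?andbT// -eq_form.
  apply: sumr_le0 => i _; have [/xP0'->|di] := boolP (0 < d 0 i).
    by rewrite normr0 expr0n mulr0.
  by rewrite mulr_le0_ge0 ?exprn_ge0// real_leNgt ?real0.
have xQ_eq0 : x *m Q = 0.
  apply/rowP => i; rewrite [RHS]mxE.
  have [ei|/xQ0'//] := boolP (0 < e 0 i).
  have /eqP := form_eq0 (fun i _ => term_ge0 i) i isT.
  by rewrite mulf_eq0 gt_eqF//= expf_eq0 normr_eq0 => /eqP.
by case/eqP: x_neq0; rewrite -[x](mulmxK Q_unit) xQ_eq0 mul0mx.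
Qed.

(** Trades the sum of multiplicities over distinct roots for a count over any
list that splits the characteristic polynomial; such counts add up under
concatenation. *)
Lemma eigenvalue_count_seq (R : rcfType) (P : pred R) n (M : 'M[R]_n)
    (s : seq R) :
  char_poly M = \prod_(x <- s) ('X - x%:P) -> eigenvalue_count P M = count P s.
Proof.
move=> eqM; rewrite /eigenvalue_count eqM; set p := \prod_(x <- s) _.
have p_neq0 : p != 0 by rewrite monic_neq0 ?monic_prod_XsubC.
have roots_undup : perm_eq (rootsR p) (undup s).
  apply: uniq_perm; rewrite ?undup_uniq ?uniq_roots// => x.
  by rewrite -roots_on_rootsR// root_prod_XsubC mem_undup.
rewrite (perm_big _ roots_undup)/= -sum1_count -[RHS]big_undup_iterop_count/=.
apply: eq_bigr => x _; rewrite mu_prod_XsubC.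
by rewrite Monoid.iteropE iter_addn_0 mul1n.
Qed.

Lemma eigenvalue_count_row (R : rcfType) (P : pred R) n (M : 'M[R]_n)
    (d : 'rV[R]_n) :
  char_poly M = \prod_i ('X - (d 0 i)%:P) ->
  eigenvalue_count P M = #|[set i | P (d 0%R i)]|.
Proof.
move=> eqM; rewrite (@eigenvalue_count_seq _ _ _ _ [seq d 0 i | i : 'I_n]).
  by rewrite count_map cardsE cardE enumT size_filter.
by rewrite big_image.
Qed.

Lemma char_poly_similar (F : fieldType) n (P M : 'M[F]_n) :
  P \in unitmx -> char_poly (invmx P *m M *m P) = char_poly M.
Proof.
move=> P_unit; rewrite /char_poly /char_poly_mx.
have -> : 'X%:M - map_mx polyC (invmx P *m M *m P) =
    map_mx polyC (invmx P) *m ('X%:M - map_mx polyC M) *m map_mx polyC P.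
  rewrite mulmxBr mulmxBl !map_mxM [_ *m 'X%:M]scalar_mxC -['X%:M *m _ *m _]mulmxA.
  by rewrite -[X in 'X%:M *m X]map_mxM mulVmx// map_mx1 mulmx1.
rewrite !det_mulmx mulrAC -det_mulmx -map_mxM mulVmx// map_mx1 det1 mul1r//.
Qed.

(** The spectral theorem over R[i] diagonalises M unitarily, and the diagonal
entries are real since M is hermitian; hence the characteristic polynomial
already splits over R. *)
Lemma real_spectral (R : rcfType) n (M : 'M[R]_n) : M^T = M ->
  exists (P : 'M[R[i]]_n) (d : 'rV[R]_n),
    [/\ P \in unitmx,
        map_mx (real_complex R) M
          = P *m diag_mx (map_mx (real_complex R) d) *m P^t* &
        char_poly M = \prod_i ('X - (d 0 i)%:P)].
Proof.
move=> M_sym; set f := real_complex R; pose Mc := map_mx f M.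
have Mc_herm : Mc \is hermsymmx.
  apply: realsym_hermsym.
    apply/is_hermitianmxP; rewrite expr0 scale1r map_mx_id//.
    by rewrite /Mc map_trmx M_sym.
  by apply/mxOverP => i j; rewrite mxE; apply/complex_realP; exists (M i j).
have /orthomx_spectralP := hermitian_normalmx Mc_herm.
have := hermitian_spectral_diag_real Mc_herm.
have := spectral_unitarymx Mc.
move: (spectralmx Mc) (spectral_diag Mc) => P dc P_unitary /mxOverP dc_real eqM.
have P_unit := unitarymx_unit P_unitary.
pose d := map_mx (@complex.Re R) dc.
have dE : dc = map_mx f d.
  by apply/rowP => i; rewrite !mxE; apply/esym/RRe_real.
exists (P^t*), d; split.
- by apply: unitarymx_unit; rewrite trmxC_unitary.
- by rewrite trmxCK -dE -invmx_unitary.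
apply: (map_poly_inj f); rewrite map_char_poly -/Mc eqM char_poly_similar//.
rewrite char_poly_trig ?diag_mx_is_trig// rmorph_prod; apply: eq_bigr => i _.
by rewrite /= map_polyXsubC dE !mxE eqxx mulr1n.
Qed.

Lemma conj_map_real (R : rcfType) m n (A : 'M[R]_(m, n)) :
  (map_mx (real_complex R) A)^t* = map_mx (real_complex R) A^T.
Proof.
rewrite map_trmx realmxC//; apply/mxOverP => i j; rewrite !mxE.
by apply/complex_realP; exists (A j i).
Qed.

Lemma card_pos_eq_congr (R : rcfType) n (P Q : 'M[R[i]]_n) (d e : 'rV[R]_n) :
  P \in unitmx -> Q \in unitmx ->
  P *m diag_mx (map_mx (real_complex R) d) *m P^t*
    = Q *m diag_mx (map_mx (real_complex R) e) *m Q^t* ->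
  #|[set i | (0 < d 0 i)%R]| = #|[set i | (0 < e 0 i)%R]|.
Proof.
move=> P_unit Q_unit eqPQ.
have real_row (c : 'rV[R]_n) : map_mx (real_complex R) c \is a realmx.
  by apply/mxOverP => i j; rewrite mxE; apply/complex_realP; exists (c i j).
have cardE (c : 'rV[R]_n) : [set i | 0 < c 0 i] =
    [set i | 0 < (map_mx (real_complex R) c) 0 i].
  by apply/setP => i; rewrite !inE mxE ltcR.
by apply/eqP; rewrite eqn_leq !cardE !(card_pos_le_congr _ _ _ eqPQ,
  card_pos_le_congr _ _ _ (esym eqPQ)).
Qed.

Lemma card_sign_split (R : realDomainType) n (d : 'rV[R]_n) :
  (#|[set i | (0 < d 0 i)%R]| + #|[set i | (d 0 i < 0)%R]|
    + #|[set i | (d 0 i == 0)%R]| = n)%N.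
Proof.
have cardE (P : pred 'I_n) : #|[set i | P i]| = (\sum_i P i)%N.
  by rewrite -sum1dep_card big_mkcond; apply: eq_bigr => i _; case: (P i).
rewrite !cardE -!big_split -[RHS]card_ord -sum1_card /=.
by apply: eq_bigr => i _; case: ltgtP.
Qed.

(** Sylvester's law of inertia. Spectral decompositions of M and N give two
diagonalisations of the form M by congruence over R[i]. Negating both compares
the negative entries, and the number of zeros is what remains. *)
Lemma inertia_congr (R : rcfType) n (M N U : 'M[R]_n) :
  N^T = N -> U \in unitmx -> M = U^T *m N *m U -> inertia M = inertia N.
Proof.
move=> N_sym U_unit eqM.
have M_sym : M^T = M by rewrite eqM !trmx_mul trmxK N_sym mulmxA.
have [P [d [P_unit PM charM]]] := real_spectral M_sym.
have [Q [e [Q_unit QN charN]]] := real_spectral N_sym.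
set f := real_complex R in PM QN.
pose Q' := map_mx f U^T *m Q.
have Q'_unit : Q' \in unitmx.
  by rewrite unitmx_mul Q_unit andbT map_unitmx unitmx_tr.
have eqPQ : P *m diag_mx (map_mx f d) *m P^t*
    = Q' *m diag_mx (map_mx f e) *m Q'^t*.
  rewrite -PM eqM !map_mxM QN trmx_mul map_mxM conj_map_real trmxK.
  by rewrite !mulmxA.
have eq_pos := card_pos_eq_congr P_unit Q'_unit eqPQ.
have eq_neg : #|[set i | (d 0 i < 0)%R]| = #|[set i | (e 0 i < 0)%R]|.
  have opp (c : 'rV[R]_n) : [set i | c 0 i < 0] = [set i | 0 < (- c) 0 i].
    by apply/setP => i; rewrite !inE mxE oppr_gt0.
  rewrite !opp; apply: (card_pos_eq_congr P_unit Q'_unit).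
  by rewrite !map_mxN !(raddfN (@diag_mx _ _))/= !mulmxN !mulNmx eqPQ.
have eq_zero : #|[set i | (d 0 i == 0)%R]| = #|[set i | (e 0 i == 0)%R]|.
  apply/eqP; rewrite -(eqn_add2l (#|[set i | (0 < d 0 i)%R]|
    + #|[set i | (d 0 i < 0)%R]|)) card_sign_split eq_pos eq_neg.
  by rewrite card_sign_split.
by rewrite /inertia !(eigenvalue_count_row _ charM,
  eigenvalue_count_row _ charN)
  eq_pos eq_neg eq_zero.
Qed.

Lemma inertia_block_diag (R : rcfType) m n (M : 'M[R]_m) (N : 'M[R]_n) :
  M^T = M -> N^T = N ->
  inertia (block_mx M 0 0 N) = inertia M + inertia N.
Proof.
move=> /real_spectral[_ [d [_ _ charM]]] /real_spectral[_ [e [_ _ charN]]].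
have enum_prod k (c : 'rV[R]_k) : \prod_i ('X - (c 0 i)%:P)
    = \prod_(x <- [seq c 0 i | i : 'I_k]) ('X - x%:P) by rewrite big_image.
rewrite enum_prod in charM; rewrite enum_prod in charN.
have charMN : char_poly (block_mx M 0 0 N) = \prod_(x <- [seq d 0 i | i : 'I_m]
    ++ [seq e 0 i | i : 'I_n]) ('X - x%:P).
  rewrite big_cat/= -charM -charN /char_poly char_block_diag_mx.
  exact: det_ublock.
by rewrite /inertia !(eigenvalue_count_seq _ charM,
  eigenvalue_count_seq _ charN, eigenvalue_count_seq _ charMN) !count_cat.
Qed.

Lemma eigenvalue_count_scalar1 (R : rcfType) (P : pred R) (s : R) :
  eigenvalue_count P (s%:M : 'M_1) = P s.
Proof.
rewrite (@eigenvalue_count_seq _ _ _ _ [:: s]) /= ?addn0//.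
rewrite char_poly_trig ?scalar_mx_is_trig// big_ord1 big_seq1 mxE eqxx mulr1n//.
Qed.

Lemma posdef_no_neg_eigenvalue (R : rcfType) n (M : 'M[R]_n) :
  posdefmx M -> eigenvalue_count (fun x => x < 0) M = 0%N.
Proof.
case=> _ M_pos; rewrite /eigenvalue_count big_seq_cond big1// => a /andP[].
have char_neq0 : char_poly M != 0 by rewrite monic_neq0 ?char_poly_monic.
rewrite -roots_on_rootsR// -eigenvalue_root_char => /eigenvalueP[v vM v_neq0].
move=> a_lt0; have := M_pos v^T; rewrite trmx_eq0 v_neq0 => /(_ isT).
rewrite trmxK vM -scalemxAl mxE ltNge mulr_le0_ge0 ?(ltW a_lt0)//.
by rewrite mxE sumr_ge0// => i _; rewrite mxE -expr2 sqr_ge0.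
Qed.
End Inertia.

(** * Real quadratic forms and Schur complements *)

Section Forms.
Variable R : realFieldType.

Definition qform n (M : 'M[R]_n) (x : 'cV[R]_n) : R := (x^T *m M *m x) 0 0.

Lemma qform_congr m n (U : 'M[R]_(m, n)) (M : 'M[R]_m) x :
  qform (U^T *m M *m U) x = qform M (U *m x).
Proof. by rewrite /qform trmx_mul !mulmxA. Qed.

Lemma qform0 n (M : 'M[R]_n) : qform M 0 = 0.
Proof. by rewrite /qform mulmx0 mxE. Qed.

Lemma posdef_qform_ge0 n (M : 'M[R]_n) x : posdefmx M -> 0 <= qform M x.
Proof.
move=> [_ M_pos]; have [->|/M_pos/ltW//] := eqVneq x 0.
by rewrite qform0.
Qed.

Lemma posdef_qform_eq0 n (M : 'M[R]_n) x :
  posdefmx M -> qform M x = 0 -> x = 0.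
Proof.
move=> [_ M_pos] Mx0; apply/eqP/negPn/negP => /M_pos.
by rewrite -/(qform M x) Mx0 ltxx.
Qed.

(** The form of G^T G at x is the sum of the squares of the entries of G x. *)
Lemma posdef_gram m n (G : 'M[R]_(m, n)) :
  (forall x : 'cV[R]_n, G *m x = 0 -> x = 0) -> posdefmx (G^T *m G).
Proof.
move=> G_inj; split=> [|x x_neq0]; first by rewrite trmx_mul trmxK.
have -> : (x^T *m (G^T *m G) *m x) 0 0 = \sum_i (G *m x) i 0 ^+ 2.
  rewrite mulmxA -mulmxA -trmx_mul mxE.
  by apply: eq_bigr => i _; rewrite mxE expr2.
have sq_ge0 i : true -> 0 <= (G *m x) i 0 ^+ 2 by rewrite sqr_ge0.
rewrite lt_neqAle sumr_ge0// andbT eq_sym psumr_neq0//.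
apply: contraNT x_neq0 => /hasPn Gx0; apply/eqP/G_inj/colP => i.
rewrite [RHS]mxE; apply/eqP; rewrite -sqrf_eq0.
have := Gx0 i (mem_index_enum i).
by rewrite /= lt_neqAle sqr_ge0 andbT eq_sym negbK.
Qed.

Lemma posdef_unit n (M : 'M[R]_n) : posdefmx M -> M \in unitmx.
Proof.
move=> M_pos; rewrite -unitmx_tr -row_free_unit -kermx_eq0.
apply/rowV0P => v /sub_kermxP vM; rewrite -[v]trmxK.
suff -> : v^T = 0 by rewrite trmx0.
apply: (posdef_qform_eq0 M_pos); rewrite /qform trmxK -mulmxA.
by rewrite -[M]trmxK -trmx_mul vM trmx0 mulmx0 mxE.
Qed.

Lemma posdef_congr n (U M : 'M[R]_n) :
  U \in unitmx -> M^T = M -> posdefmx (U^T *m M *m U) <-> posdefmx M.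
Proof.
move=> U_unit M_sym; split=> -[_ pos]; split=> //.
- move=> x x_neq0; have := pos (invmx U *m x).
  rewrite -/(qform _ _) qform_congr mulKVmx//; apply.
  apply: contraNneq x_neq0 => /(congr1 (mulmx U)).
  by rewrite mulKVmx// mulmx0 => ->.
- by rewrite !trmx_mul trmxK M_sym mulmxA.
- move=> x x_neq0; rewrite -/(qform _ _) qform_congr; apply: pos.
  apply: contraNneq x_neq0 => /(congr1 (mulmx (invmx U))).
  by rewrite mulKmx// mulmx0 => ->.
Qed.

Lemma qform_block_diag n (A : 'M[R]_n) s (x : 'cV[R]_(n + 1)) :
  qform (block_mx A 0 0 s%:M) x = qform A (usubmx x) + s * (dsubmx x) 0 0 ^+ 2.
Proof.
rewrite -{1}[x]vsubmxK /qform tr_col_mx mul_row_block !mulmx0 addr0 add0r.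
rewrite mul_row_col mxE; congr (_ + _); rewrite mul_mx_scalar -scalemxAl mxE.
by rewrite mxE big_ord1 !mxE expr2.
Qed.

Lemma block_diag_scalar_sym n (A : 'M[R]_n) (s : R) :
  A^T = A -> (block_mx A 0 0 (s%:M : 'M_1))^T = block_mx A 0 0 s%:M.
Proof. by move=> A_sym; rewrite tr_block_mx !trmx0 A_sym tr_scalar_mx. Qed.

Definition shear n (w : 'cV[R]_n) : 'M[R]_(n + 1) := block_mx 1%:M w 0 1%:M.

Lemma shear_unit n (w : 'cV[R]_n) : shear w \in unitmx.
Proof. by rewrite unitmxE det_ublock !det1 mulr1 unitr1. Qed.

Lemma mul_shear n (w : 'cV[R]_n) (x : 'cV[R]_(n + 1)) :
  shear w *m x = col_mx (usubmx x + w *m dsubmx x) (dsubmx x).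
Proof. by rewrite -{1}[x]vsubmxK mul_block_col !mul1mx mul0mx add0r. Qed.

(** Block elimination of c, without inverting A: a solution w of A w = c is
enough. *)
Lemma schur_congr n (A : 'M[R]_n) (c w : 'cV[R]_n) (k s : R) :
  A^T = A -> A *m w = c -> s = k - (c^T *m w) 0 0 ->
  block_mx A c c^T k%:M = (shear w)^T *m block_mx A 0 0 s%:M *m shear w.
Proof.
move=> A_sym Aw ->; have wA : w^T *m A = c^T by rewrite -Aw trmx_mul A_sym.
rewrite /shear tr_block_mx !trmx1 trmx0 !mulmx_block.
rewrite !mulmx1 !mul1mx !mulmx0 !mul0mx !addr0 !add0r wA Aw.
congr block_mx; apply/matrixP => i j; rewrite !ord1 !mxE eqxx !mulr1n.
by rewrite addrC subrK.
Qed.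

Lemma principal_submxE n (J : {set 'I_n}) (M : 'M[R]_n) :
  let E := colsub (@enum_val _ (mem J)) 1%:M in
  principal_submx J M = E^T *m M *m E.
Proof.
by rewrite /= mulmx_colsub mulmx1 trmx_mxsub trmx1 mul_rowsub_mx mul1mx;
  apply/matrixP => i j; rewrite !mxE.
Qed.

(** Here the Schur complement is 0, so the form at y = (a, t) equals the form of
A at a + w t, and it vanishes only if y = t (-w, 1). A vector supported on J has
a zero coordinate, and no coordinate of (-w, 1) is zero, so t = 0 and y = 0. *)
Lemma posdef_principal_schur n (A : 'M[R]_n) (c w : 'cV[R]_n) (k : R)
    (J : {set 'I_(n + 1)}) :
  posdefmx A -> A *m w = c -> k = (c^T *m w) 0 0 ->
  (forall i, w i 0 != 0) -> J \proper [set: 'I_(n + 1)] ->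
  posdefmx (principal_submx J (block_mx A c c^T k%:M)).
Proof.
move=> A_pos Aw kE w_neq0 /properP[_ [i0 _ i0J]].
have A_sym := A_pos.1.
have s0 : 0 = k - (c^T *m w) 0 0 by rewrite -kE subrr.
rewrite principal_submxE; set E := colsub _ _.
rewrite (schur_congr A_sym Aw s0); split.
  by rewrite !trmx_mul !trmxK block_diag_scalar_sym// !mulmxA.
move=> x x_neq0; rewrite -/(qform _ _) !qform_congr qform_block_diag mul0r addr0.
(* y is x extended by zero outside J. *)
set y := E *m x; rewrite mul_shear col_mxKu.
rewrite lt_neqAle posdef_qform_ge0// andbT eq_sym.
apply: contraNneq x_neq0 => /(posdef_qform_eq0 A_pos) /eqP.
rewrite addr_eq0 => /eqP yu.
have EtE : E^T *m E = 1%:M.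
  rewrite trmx_mxsub trmx1 mul_rowsub_mx mul1mx; apply/matrixP => i j.
  by rewrite !mxE (inj_eq enum_val_inj).
have y_i0 : y i0 0 = 0.
  rewrite mxE big1// => j _; rewrite !mxE.
  case: eqP => [i0E|]; last by rewrite mul0r.
  by case/negP: i0J; rewrite i0E; exact: enum_valP.
have yd0 : dsubmx y 0 0 = 0.
  case: (split_ordP i0) y_i0 => i -> y_i0; last first.
    by rewrite mxE; rewrite (ord1 i) in y_i0.
  have /eqP : usubmx y i 0 = 0 by rewrite mxE.
  rewrite yu mxE mxE big_ord1 oppr_eq0 mulf_eq0 (negPf (w_neq0 i)).
  by move/eqP.
have {}yd0 : dsubmx y = 0 by apply/colP => i; rewrite (ord1 i) yd0 mxE.
have y0 : y = 0 by rewrite -[y]vsubmxK yu yd0 mulmx0 oppr0 col_mx0.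
by apply/eqP; rewrite -[x]mul1mx -EtE -mulmxA -/y y0 mulmx0.
Qed.
End Forms.


(** * Cartan matrices of type A *)

Section Cartan.
Variable R : realFieldType.

Definition cartanR r : 'M[R]_r := map_mx intr (cartanA r).
Definition star_legR r : 'cV[R]_r := map_mx intr (star_leg r).

(** The difference operator sending (x_0, ..., x_{r-1}) to
(x_0, x_1 - x_0, ..., x_{r-1} - x_{r-2}, - x_{r-1}): successive differences of x
padded with a zero at both ends. *)
Definition diffmx r : 'M[R]_(r.+1, r) :=
  \matrix_(i, j) ((i == j :> nat)%:R - (i == j.+1 :> nat)%:R).

Lemma sum_delta_nat n (F : nat -> R) a :
  \sum_(i < n) (i == a :> nat)%:R * F i = if (a < n)%N then F a else 0.
Proof.
have [lt_an|le_na] := ltnP a n.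
  rewrite (bigD1 (Ordinal lt_an))//= eqxx mul1r big1 ?addr0// => i.
  by rewrite -val_eqE/= => /negPf->; rewrite mul0r.
rewrite big1// => i _; rewrite ltn_eqF ?mul0r//.
exact: leq_trans (ltn_ord i) le_na.
Qed.

Lemma mul_diffmx r (F : nat -> R) i :
  (diffmx r *m (\col_j F j)) i 0 =
    (if (i < r)%N then F i else 0) - (if (0 < i)%N then F i.-1 else 0).
Proof.
rewrite mxE; under eq_bigr do rewrite !mxE mulrBl.
rewrite sumrB; congr (_ - _).
  by rewrite -sum_delta_nat; apply: eq_bigr => j _; rewrite eq_sym.
case: i => -[|i] i_le /=; first by rewrite big1// => j _; rewrite mul0r.
transitivity (if (i < r)%N then F i else 0); last by rewrite -ltnS i_le.
rewrite -sum_delta_nat.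
by apply: eq_bigr => j _; rewrite eqSS eq_sym.
Qed.

(** The first entry of the image gives x_0 = 0, and each of the following ones
then propagates the zero. *)
Lemma diffmx_inj r (x : 'cV[R]_r) : diffmx r *m x = 0 -> x = 0.
Proof.
(* Extending x to all of nat turns the kernel condition into a recursion. *)
pose F k := if insub k is Some j then x j 0 else 0.
have -> : x = \col_j F j.
  by apply/colP => j; rewrite mxE /F valK.
move=> Gx0; have F0 k : (k < r)%N -> F k = 0.
  elim: k => [|k IHk] lt_kr.
    have /colP/(_ ord0) := Gx0; rewrite mul_diffmx lt_kr mxE.
    by rewrite subr0.
  have /colP/(_ (Ordinal (ltnW lt_kr : (k.+1 < r.+1)%N))) := Gx0.
  by rewrite mul_diffmx lt_kr/= mxE IHk ?subr0// ltnW.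
by apply/colP => j; rewrite !mxE F0.
Qed.

(** The form of A_r is x_0^2 + sum (x_{i+1} - x_i)^2 + x_{r-1}^2. *)
Lemma cartanR_gram r : cartanR r = (diffmx r)^T *m diffmx r.
Proof.
apply/matrixP => j l; rewrite [RHS]mxE.
pose F i : R := (i == l :> nat)%:R - (i == l.+1 :> nat)%:R.
(* F i is the entry (i, l) of the difference operator. *)
transitivity (F j - F j.+1).
  rewrite !mxE /F -val_eqE eqSS /=; move: (j : nat) (l : nat) => a b.
  by repeat (case: eqP => ? /=); try lia; rewrite ?rmorphN /=; ring.
under eq_bigr => i _.
  have -> : (diffmx r)^T j i * diffmx r i l
      = (i == j :> nat)%:R * F i - (i == j.+1 :> nat)%:R * F i.
    by rewrite !mxE mulrBl.
  over.
by rewrite sumrB !sum_delta_nat ltnS ltnW// ltnS ltn_ord.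
Qed.

Lemma cartanR_posdef r : posdefmx (cartanR r).
Proof. by rewrite cartanR_gram; apply/posdef_gram/diffmx_inj. Qed.

Definition leg_sol r : 'cV[R]_r := \col_j (- (j.+1%:R / r.+1%:R)).

(** The entries of [leg_sol] decrease linearly, so its differences are all
-1/(r+1), except that the last one, which returns to 0, is larger by 1. The
transposed operator kills constants, and sends the last basis vector to the leg
vector. *)
Lemma cartanR_leg_sol r : cartanR r *m leg_sol r = star_legR r.
Proof.
rewrite cartanR_gram -mulmxA.
pose F i : R := (i == r :> nat)%:R - r.+1%:R^-1.
have -> : diffmx r *m leg_sol r = \col_i F i.
  apply/colP => i; rewrite (mul_diffmx (fun j => - (j.+1%:R / r.+1%:R))).
  have r_neq0 : (r.+1%:R : R) != 0 by rewrite pnatr_eq0.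
  rewrite mxE /F; have := ltn_ord i; rewrite ltnS leq_eqVlt.
  move: (i : nat) => {}i /orP[/eqP->|lt_ir].
    rewrite ltnn eqxx; case: r r_neq0 {F} => [|r'] r_neq0 /=; first by field.
    rewrite -[r'.+2%:R]natr1 in r_neq0 *.
    by move: (r'.+1%:R) r_neq0 => y y1_neq0; field.
  rewrite lt_ir ltn_eqF//; move: (r.+1%:R) r_neq0 => z z_neq0.
  case: i {lt_ir} => [|i] /=; first by field.
  by rewrite -[i.+2%:R]natr1; move: (i.+1%:R) => y; field.
apply/colP => j; rewrite mxE.
under eq_bigr => i _.
  have -> : (diffmx r)^T j i * (\col_i F i) i 0
      = (i == j :> nat)%:R * F i - (i == j.+1 :> nat)%:R * F i.
    by rewrite !mxE mulrBl.
  over.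
rewrite sumrB !sum_delta_nat ltnS ltnW// ltnS ltn_ord /F !mxE ltn_eqF//.
by case: eqP => _; rewrite ?rmorphN ?rmorph1 ?rmorph0 /=; ring.
Qed.

Lemma leg_dot_sol r :
  ((star_legR r)^T *m leg_sol r) 0 0 = 1 - r.+1%:R^-1.
Proof.
(* Only the last entry contributes; a leg of length 0 has none. *)
pose F j : R := j.+1%:R / r.+1%:R.
transitivity (if (0 < r)%N then F r.-1 else 0); last first.
  rewrite /F {F}; case: r => [|r] /=; first by rewrite invr1 subrr.
  have r_neq0 : (r.+2%:R : R) != 0 by rewrite pnatr_eq0.
  rewrite -[r.+2%:R]natr1 in r_neq0 *.
  by move: (r.+1%:R) r_neq0 => y y1_neq0; field.
rewrite mxE; case: r @F => [|r] F; first by rewrite big_ord0.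
transitivity (if (r < r.+1)%N then F r else 0); last by rewrite ltnSn.
rewrite -sum_delta_nat; apply: eq_bigr => j _; rewrite !mxE eqSS /F.
by case: eqP => _; rewrite ?rmorphN ?rmorph1 ?rmorph0 /=; ring.
Qed.

End Cartan.


(** * The weighted star matrix *)

Section Star.
Variable R : realFieldType.
Variables (m : nat) (r : 'I_m -> nat).

Lemma map_star_diag :
  map_mx intr (star_diag r) = \mxdiag_i cartanR R (r i).
Proof.
apply/matrixP => s t; rewrite !mxE.
move: (tagnat.sig1 s) (tagnat.sig2 s) (tagnat.sig1 t) (tagnat.sig2 t).
move=> i k j l; case: eqVneq l => [<-|_] l; last by rewrite !mxE rmorph0.
by rewrite !conform_mx_id [RHS]mxE.
Qed.

Lemma map_star_col : map_mx intr (star_col r) = \mxcol_i star_legR R (r i).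
Proof. by apply/matrixP => s t; rewrite !mxE. Qed.

Lemma mxdiag_posdef (A : forall i, 'M[R]_(r i)) :
  (forall i, posdefmx (A i)) -> posdefmx (\mxdiag_i A i).
Proof.
move=> A_pos; split=> [|x x_neq0].
  by rewrite tr_mxdiag; apply: eq_mxdiag => i; have [] := A_pos i.
have -> : (x^T *m \mxdiag_i A i *m x) 0 0 = \sum_i qform (A i) (submxcol x i).
  rewrite -{1 2}[x]submxcolK tr_mxcol mul_mxrow_mxdiag mul_mxrow_mxcol summxE.
  by [].
have form_ge0 i : true -> 0 <= qform (A i) (submxcol x i).
  by move=> _; apply: posdef_qform_ge0.
rewrite lt_neqAle sumr_ge0// andbT eq_sym.
apply: contraNneq x_neq0 => /(psumr_eq0P form_ge0) form0.
apply/eqP/mxcolP => i; rewrite submxcol0.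
exact: posdef_qform_eq0 (A_pos i) (form0 i isT).
Qed.

(** The solution w of D w = c. *)
Definition star_sol : 'cV[R]_(\sum_i r i) := \mxcol_i leg_sol R (r i).

Lemma star_sol_neq0 i : star_sol i 0 != 0.
Proof. by rewrite !mxE oppr_eq0 mulf_neq0 ?invr_eq0 ?pnatr_eq0. Qed.

Lemma star_SE (k : int) :
  star_S R k r = k%:~R - ((\mxcol_i star_legR R (r i))^T *m star_sol) 0 0.
Proof.
rewrite tr_mxcol mul_mxrow_mxcol summxE; under eq_bigr do rewrite leg_dot_sol.
rewrite sumrB sumr_const card_ord /star_S opprB addrA.
by rewrite addrAC.
Qed.

End Star.

Theorem theorem4p2 (R : rcfType) (m : nat) (r : 'I_m -> nat) (k : int)
    (hm : (2 <= m)%N) (hr : forall i, (0 < r i)%N) (hk : 0 < k) :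
  let D : 'M[R]_(\sum_i r i) := map_mx intr (star_diag r) in
  let B : 'M[R]_(\sum_i r i + 1) := map_mx intr (star_mx k r) in
  let S : R := star_S R k r in
  [/\ posdefmx D /\ inertia B = inertia D + inertia (S%:M : 'M[R]_1),
      posdefmx B <-> 0 < S,
      (possemidefmx B /\ corank B = 1%N) <-> S = 0,
      eigenvalue_count (fun x => x < 0) B = 1%N <-> S < 0 &
      S = 0 -> forall J : {set 'I_(\sum_i r i + 1)},
        J \proper [set: 'I_(\sum_i r i + 1)] ->
        posdefmx (principal_submx J B)].
Proof.
move=> D B S; set n := (\sum_i r i)%N in D B *.
pose c : 'cV[R]_n := map_mx intr (star_col r); pose w := star_sol R r.
have D_pos : posdefmx D.
  by rewrite /D map_star_diag; apply: mxdiag_posdef => i; apply: cartanR_posdef.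
have D_sym := D_pos.1.
have Dw : D *m w = c.
  rewrite /D /c map_star_diag map_star_col mul_mxdiag_mxcol.
  by apply: eq_mxcol => i; apply: cartanR_leg_sol.
have SE : S = k%:~R - (c^T *m w) 0 0 by rewrite /S star_SE /c map_star_col.
have BE : B = block_mx D c c^T (k%:~R)%:M.
  by rewrite /B map_block_mx map_trmx map_scalar_mx.
pose N : 'M[R]_(n + 1) := block_mx D 0 0 S%:M.
have N_sym : N^T = N by apply: block_diag_scalar_sym.
have BN : B = (shear w)^T *m N *m shear w by rewrite BE; apply: schur_congr.
have U_unit := shear_unit w.
have B_inertia : inertia B = inertia D + inertia (S%:M : 'M[R]_1).
  by rewrite (inertia_congr N_sym U_unit BN) inertia_block_diag// tr_scalar_mx.
(* The vector with D-part 0 and last coordinate 1 isolates S. *)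
have N_last : qform N (col_mx 0 1%:M) = S.
  by rewrite qform_block_diag col_mxKu col_mxKd qform0 add0r mxE expr1n mulr1.
split.
- by [].
- rewrite BN posdef_congr//; split=> [[_ N_pos]|S_gt0].
    rewrite -N_last; apply: N_pos; rewrite col_mx_eq0 negb_and orbC.
    by apply/orP; left; apply/eqP => /matrixP/(_ 0 0)/eqP; rewrite !mxE oner_eq0.
  split=> // x x_neq0; rewrite -/(qform _ _) qform_block_diag lt_neqAle.
  have Dx_ge0 := posdef_qform_ge0 (usubmx x) D_pos.
  have Sx_ge0 : 0 <= S * dsubmx x 0 0 ^+ 2 by rewrite mulr_ge0 ?sqr_ge0 ?ltW.
  rewrite addr_ge0// andbT eq_sym paddr_eq0//; apply: contraNN x_neq0.
  case/andP => /eqP/(posdef_qform_eq0 D_pos) xu0.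
  rewrite mulf_eq0 gt_eqF//= sqrf_eq0 => /eqP xd0.
  rewrite -[x]vsubmxK xu0; apply/eqP; rewrite -[RHS]col_mx0; congr col_mx.
  by apply/colP => i; rewrite (ord1 i) xd0 mxE.
- have corankE : corank B = (S == 0) :> nat.
    have SM0 : (S%:M == 0 :> 'M_1) = (S == 0).
      apply/eqP/eqP => [/matrixP/(_ 0 0)|->]; last exact: raddf0.
      by rewrite !mxE.
    rewrite /corank mxrank_coker BN mxrankMfree ?row_free_unit//.
    rewrite -mxrank_tr trmx_mul trmxK mxrankMfree ?row_free_unit// N_sym.
    rewrite rank_diag_block_mx rank_rV mxrank_unit ?posdef_unit// subnDl.
    by rewrite SM0; case: eqP.
  rewrite corankE; split=> [[_]|S0]; first by case: eqP.
  rewrite S0 eqxx; split=> //; split.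
    by rewrite BN !trmx_mul trmxK N_sym mulmxA.
  move=> x; rewrite -/(qform _ _) BN qform_congr qform_block_diag S0 mul0r addr0.
  exact: posdef_qform_ge0.
- have -> : eigenvalue_count (fun x => x < 0) B = (S < 0) :> nat.
    have := congr1 (fun t => t.1.2) B_inertia => /= ->.
    by rewrite posdef_no_neg_eigenvalue// eigenvalue_count_scalar1.
  by case: (S < 0).
- move=> S0 J J_proper; rewrite BE.
  apply: posdef_principal_schur Dw _ _ J_proper => //.
    by apply/eqP; rewrite -subr_eq0 -SE S0.
  exact: star_sol_neq0.
Qed.
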